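(* Let $\theta>0$, let $N\ge1$ be an integer and $k\in\mathbb{N}$. The factorial moment $M^{\theta}(k,N)$ of the Charlier ensemble can be written as $$M^{\theta}(k,N)=\theta^k\;{}_3F_1\left(\begin{matrix}-k,-k,1-N\\ 2\end{matrix};-\frac1\theta\right).$$ In particular, for fixed $N$, the function $k\mapsto\theta^{-k}M^{\theta}(k,N)$ can be extended to the entire complex plane to a polynomial in $k$ of degree $2(N-1)$; and for each fixed $k\in\mathbb{N}$, $\theta^{-k}M^{\theta}(k,N)$ is a polynomial in $(N-1)$ of degree $k$.
   Context: Conventions: $\mathbb{N}=\{0,1,2,\dots\}$; an empty product is $1$. Hypergeometric notation: $(a)_i=a(a+1)\cdots(a+i-1)$ and ${}_pF_q\left(\begin{matrix}a_1,\dots,a_p\\ b_1,\dots,b_q\end{matrix};z\right)=\sum_{i\ge0}\frac{(a_1)_i\cdots(a_p)_i}{(b_1)_i\cdots(b_q)_i}\frac{z^i}{i!}$, which terminates if some $a_j$ is a nonpositive integer. The Poisson measure is $\mu^{\theta}(x)=\theta^xe^{-\theta}/x!$, $x\in\mathbb{N}$. The normalised Charlier polynomials (orthonormal with respect to $\mu^\theta$) are $$c_n(x;\theta)=\sqrt{\frac{\theta^n}{n!}}\;{}_2F_0\left(\begin{matrix}-n,-x\\ -\end{matrix};-\frac1\theta\right),\quad n\in\mathbb{N}.$$ The Charlier one-point function with $N$ particles is the probability mass function on $\mathbb{N}$ $$\rho_N^{\theta}(x)=\frac1N\sum_{n=0}^{N-1}c_n(x;\theta)^2\mu^\theta(x),$$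 and the factorial moment is $M^\theta(k,N)=\sum_{x\in\mathbb{N}}x(x-1)\cdots(x-k+1)\,\rho_N^\theta(x)$. *)

(* Defs.v *)
From HB Require Import structures.
From mathcomp Require Export all_boot all_order all_algebra.
From mathcomp Require Export all_classical all_reals all_analysis.
From mathcomp Require Export complex.

Set Implicit Arguments.
Unset Strict Implicit.
Unset Printing Implicit Defensive.

Import Order.TTheory GRing.Theory Num.Theory.
Import numFieldNormedType.Exports.

Local Open Scope classical_set_scope.
Local Open Scope ring_scope.

Definition pochhammer (R : realType) (a : R) (i : nat) : R :=
  \prod_(j < i) (a + j%:R).

Definition hypergeom_term (R : realType) (s t : seq R) (z : R) (i : nat) : R :=
  (\prod_(a <- s) pochhammer a i) / (\prod_(b <- t) pochhammer b i) *
  (z ^+ i / i`!%:R).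

(* s and t hold the upper and the lower parameters of pFq.  If some element of
   s is a nonpositive integer, the terms vanish from some rank on and the limit
   is a finite sum. *)
Definition hypergeom (R : realType) (s t : seq R) (z : R) : R :=
  limn (series (hypergeom_term s t z)).

Definition charlier (R : realType) (theta : R) (n : nat) (x : R) : R :=
  Num.sqrt (theta ^+ n / n`!%:R) *
  hypergeom [:: - n%:R; - x] [::] (- theta^-1).

(* poisson_pmf theta x is theta^x e^-theta / x! only for 0 < theta; the library
   sets it to 1 otherwise. *)
Definition charlier_one_point (R : realType) (theta : R) (N x : nat) : R :=
  N%:R^-1 *
  \sum_(n < N) charlier theta n x%:R ^+ 2 * poisson_pmf theta x.

Definition factorial_moment_term (R : realType) (theta : R) (k N x : nat) : R :=
  (x ^_ k)%:R * charlier_one_point theta N x.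

(* The limit is meaningful only when the series converges, which has to be
   asserted separately. *)
Definition factorial_moment (R : realType) (theta : R) (k N : nat) : R :=
  limn (series (factorial_moment_term theta k N)).

(* Main.v *)
(** The Poisson measure satisfies E[X(X-1)...(X-j+1) f(X)] = theta^j E[f(X+j)].
    Hence, with C_n = 2F0(-n, -x; -; -1/theta), the mean of C_m f is up to sign
    the mean of the m-th difference of f.  The differences of C_n are multiples
    of C_{n-1}, ..., C_0, which gives orthogonality.  Moreover
    E[X(X-1)...(X-k+1) C_n(X)^2] = theta^k E[C_n(X+k)^2], and Newton's expansion
    of C_n(x+k) in the differences of C_n at x, together with orthogonality,
    yields for the normalised polynomials the value
    theta^k \sum_i binom(k,i)^2 n(n-1)...(n-i+1) theta^-i.  The sum over n < N is
    the hockey-stick identity for falling factorials. *)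
Require Import Defs.
From mathcomp Require Import all_boot all_order all_algebra.
From mathcomp Require Import all_classical all_reals all_analysis.
From mathcomp Require Import complex.
From mathcomp Require Import ring.

Import Order.TTheory GRing.Theory Num.Theory.
Import numFieldNormedType.Exports.

Local Open Scope classical_set_scope.
Local Open Scope ring_scope.

(** * Terminating series and Pochhammer symbols *)

Lemma cvg_series_finite_support {R : realType} (u : nat -> R) (n : nat) :
  (forall i, (n <= i)%N -> u i = 0) ->
  series u @ \oo --> \sum_(i < n) u i.
Proof.
move=> u0; apply: cvg_near_cst; exists n => // m /= nm.
rewrite /series /= (@big_cat_nat _ _ _ n) //= big_mkord.
rewrite [X in _ + X]big1_seq ?addr0 //.
by move=> i /andP[_]; rewrite mem_index_iota => /andP[/u0].
Qed.

Lemma hypergeom_finite {R : realType} (s t : seq R) (z : R) (n : nat) :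
  (forall i, (n <= i)%N -> hypergeom_term s t z i = 0) ->
  hypergeom s t z = \sum_(i < n) hypergeom_term s t z i.
Proof.
by move=> u0; apply: cvg_lim => //; apply: cvg_series_finite_support.
Qed.

(** Each factor -n + j is -(n - j); once j passes n, the zero factor at j = n matches the vanishing
    of [n ^_ i]. *)
Lemma pochhammerN {R : realType} (n i : nat) :
  pochhammer (- n%:R : R) i = (-1) ^+ i * (n ^_ i)%:R.
Proof.
elim: i => [|i IH]; first by rewrite /pochhammer big_ord0 ffactn0 mulr1.
rewrite /pochhammer big_ord_recr /= -/(pochhammer _ _) IH ffactnSr exprS natrM.
have [le_in|lt_ni] := leqP i n; first by rewrite natrB //; ring.
by rewrite ffact_small //; ring.
Qed.

Lemma pochhammer2 {R : realType} (i : nat) :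
  pochhammer (2 : R) i = i.+1`!%:R.
Proof.
elim: i => [|i IH]; first by rewrite /pochhammer big_ord0.
rewrite /pochhammer big_ord_recr /= -/(pochhammer _ _) IH (factS i.+1) natrM.
by rewrite -[2]/(2%:R) -natrD mulrC.
Qed.

(** * Charlier polynomials and their forward differences *)

(* 2F0(-n, -x; -; -1/theta), expanded in falling factorials of x. *)
Definition charlier_poly {R : realType} (theta : R) (n x : nat) : R :=
  \sum_(j < n.+1) (-1) ^+ j * 'C(n, j)%:R * theta ^- j * (x ^_ j)%:R.

Lemma charlierE {R : realType} (theta : R) (n x : nat) :
  charlier theta n x%:R =
  Num.sqrt (theta ^+ n / n`!%:R) * charlier_poly theta n x.
Proof.
have termE i : hypergeom_term [:: - n%:R; - x%:R] [::] (- theta^-1) i =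
    (-1) ^+ i * 'C(n, i)%:R * theta ^- i * (x ^_ i)%:R.
  rewrite /hypergeom_term !big_cons !big_nil !pochhammerN -bin_ffact natrM.
  have fi0 : i`!%:R != 0 :> R by rewrite pnatr_eq0 -lt0n fact_gt0.
  have sE : (-1) ^+ i * (-1) ^+ i = 1 :> R by rewrite -expr2 sqrr_sign.
  rewrite mulr1 divr1 [(- theta^-1) ^+ i]exprNn exprVn.
  (* Two signs come from the Pochhammer symbols and one from the argument, so a single (-1)^i
     survives. *)
  transitivity (((-1) ^+ i * (-1) ^+ i) * (i`!%:R / i`!%:R) *
    ((-1) ^+ i * 'C(n, i)%:R * theta ^- i * (x ^_ i)%:R)); first by ring.
  by rewrite sE divff // !mul1r.
rewrite /charlier; congr (_ * _); rewrite (hypergeom_finite _ _ _ n.+1).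
  by apply: eq_bigr => i _; rewrite termE.
by move=> i lt_ni; rewrite termE bin_small // mulr0 !mul0r.
Qed.

Lemma charlier_poly0 {R : realType} (theta : R) (x : nat) :
  charlier_poly theta 0 x = 1.
Proof. by rewrite /charlier_poly big_ord1 /= bin0 ffactn0 invr1 !mulr1. Qed.

(** Compare coefficients: a unit shift turns the falling factorial of order j+1 into itself plus j+1
    times the one of order j, and (j+1) binom(n,j+1) = n binom(n-1,j). For n = 0 the factor n makes
    [n.-1] harmless. *)
Lemma charlier_polyS {R : realType} (theta : R) (n x : nat) : theta != 0 ->
  charlier_poly theta n x.+1 =
  charlier_poly theta n x - n%:R / theta * charlier_poly theta n.-1 x.
Proof.
move=> t0; case: n => [|n]; first by rewrite !charlier_poly0; ring.
rewrite {1 2}/charlier_poly !(big_ord_recl n.+1) /= -!addrA; congr (_ + _).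
rewrite mulr_sumr -sumrB; apply: eq_bigr => j _; rewrite /bump leq0n /= add1n.
have -> : (x.+1 ^_ j.+1)%:R = (x ^_ j.+1)%:R + j.+1%:R * (x ^_ j)%:R :> R.
  rewrite ffactSS ffactnSr -!natrM -natrD.
  have [le_jx|lt_xj] := leqP j x; last by rewrite ffact_small // !muln0.
  by congr _%:R; rewrite (mulnC (x ^_ j)) -mulnDl addnS subnK.
have bE : j.+1%:R * 'C(n.+1, j.+1)%:R = n.+1%:R * 'C(n, j)%:R :> R.
  by rewrite -!natrM mul_bin_diag.
rewrite !exprS invfM.
transitivity ((-1 * (-1) ^+ j) * 'C(n.+1, j.+1)%:R * (theta^-1 * theta ^- j) *
  (x ^_ j.+1)%:R - (j.+1%:R * 'C(n.+1, j.+1)%:R) / theta *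
  ((-1) ^+ j * theta ^- j * (x ^_ j)%:R)); first by ring.
by rewrite bE; ring.
Qed.

(* The i-th forward difference of [charlier_poly theta n]. *)
Definition charlier_diff {R : realType} (theta : R) (n i x : nat) : R :=
  (-1) ^+ i * (n ^_ i)%:R * theta ^- i * charlier_poly theta (n - i) x.

Lemma charlier_diffS {R : realType} (theta : R) (n i x : nat) : theta != 0 ->
  charlier_diff theta n i x.+1 =
  charlier_diff theta n i x + charlier_diff theta n i.+1 x.
Proof.
move=> t0; rewrite /charlier_diff charlier_polyS // subnS ffactnSr natrM.
by rewrite !exprS invfM; ring.
Qed.

(** Newton's forward difference formula, by induction on the shift and Pascal's rule. *)
Lemma charlier_diffD {R : realType} (theta : R) (n i x k : nat) : theta != 0 ->
  charlier_diff theta n i (x + k) =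
  \sum_(l < k.+1) 'C(k, l)%:R * charlier_diff theta n (i + l) x.
Proof.
move=> t0; elim: k x => [|k IH] x.
  by rewrite big_ord1 bin0 mul1r !addn0.
rewrite addnS -addSn IH.
under eq_bigr => l _ do rewrite charlier_diffS // mulrDr.
rewrite big_split /= [RHS]big_ord_recl /=.
under [X in _ = _ + X]eq_bigr => l _ do
  rewrite /bump leq0n add1n binS natrD mulrDl addnS.
rewrite big_split /= addrA; congr (_ + _).
(* The range may be extended by l = k+1 because binom(k,k+1) = 0; the two sums then agree after
   splitting off l = 0. *)
have -> : \sum_(l < k.+1) 'C(k, l)%:R * charlier_diff theta n (i + l) x =
    \sum_(l < k.+2) 'C(k, l)%:R * charlier_diff theta n (i + l) x.
  by rewrite [RHS]big_ord_recr /= bin_small // mul0r addr0.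
rewrite big_ord_recl /= !bin0; congr (_ + _).
by apply: eq_bigr => l _; rewrite /bump leq0n add1n addnS.
Qed.

(** * Means with respect to the Poisson measure *)

(** A relation rather than a limit value, so that every computed mean also carries the convergence
    of its series. *)
Definition poisson_mean {R : realType} (theta : R) (f : nat -> R) (l : R) :=
  series (fun x => f x * poisson_pmf theta x) @ \oo --> l.

Lemma poisson_mean_ext {R : realType} (theta : R) (f g : nat -> R) (l : R) :
  f =1 g -> poisson_mean theta f l -> poisson_mean theta g l.
Proof. by move=> /funext ->. Qed.

Lemma poisson_mean1 {R : realType} (theta : R) : 0 < theta ->
  poisson_mean theta (fun=> 1) 1.
Proof.
move=> t0; rewrite /poisson_mean.
have -> : series (fun x => 1 * poisson_pmf theta x) =
    (fun n => series (exp_coeff theta) n * expR (- theta)).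
  apply/funext => n; rewrite /series /= mulr_suml; apply: eq_bigr => i _.
  by rewrite /poisson_pmf t0 mul1r.
rewrite -(expRxMexpNx_1 theta); apply: cvgMr_tmp.
exact: is_cvg_series_exp_coeff.
Qed.

Lemma poisson_meanZ {R : realType} (theta : R) (f : nat -> R) (l c : R) :
  poisson_mean theta f l -> poisson_mean theta (fun x => c * f x) (c * l).
Proof.
rewrite /poisson_mean => fl.
have -> : series (fun x => c * f x * poisson_pmf theta x) =
    (fun n => c * series (fun x => f x * poisson_pmf theta x) n).
  apply/funext => n; rewrite /series /= mulr_sumr; apply: eq_bigr => i _.
  by rewrite mulrA.
exact: cvgMl_tmp.
Qed.

Lemma poisson_mean_sum {R : realType} (theta : R) (n : nat)
    (f : 'I_n -> nat -> R) (l : 'I_n -> R) :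
  (forall i, poisson_mean theta (f i) (l i)) ->
  poisson_mean theta (fun x => \sum_(i < n) f i x) (\sum_(i < n) l i).
Proof.
rewrite /poisson_mean => fl.
have -> : series (fun x => (\sum_(i < n) f i x) * poisson_pmf theta x) =
    (fun m => \sum_(i < n) series (fun x => f i x * poisson_pmf theta x) m).
  apply/funext => m; rewrite /series /= exchange_big; apply: eq_bigr => i _.
  by rewrite mulr_suml.
by apply: cvg_big => //; exact: add_continuous.
Qed.

(** The terms x < k vanish; after the index shift x -> x + k the falling factorial cancels against
    (x+k)! and leaves theta^k times the Poisson weight at x. *)
Lemma poisson_mean_ffact {R : realType} (theta : R) (k : nat) (f : nat -> R)
    (l : R) : 0 < theta ->
  poisson_mean theta (fun x => f (x + k)%N) l ->
  poisson_mean theta (fun x => (x ^_ k)%:R * f x) (theta ^+ k * l).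
Proof.
move=> t0 fl; rewrite /poisson_mean -(cvg_shiftn k).
rewrite [X in X @ _ --> _](_ : _ = series (fun x =>
  (theta ^+ k * f (x + k)%N) * poisson_pmf theta x)); first exact: poisson_meanZ.
apply/funext => n /=; rewrite /series /= (@big_cat_nat _ _ _ k) ?leq_addl //=.
rewrite [X in X + _]big1_seq ?add0r; last first.
  move=> i /andP[_]; rewrite mem_index_iota => /andP[_ /ffact_small ->].
  by rewrite !mul0r.
rewrite -{1}[k]add0n big_addn addnK; apply: eq_bigr => x _.
rewrite /poisson_pmf t0 -(@ffact_fact (x + k) k) ?leq_addl // addnK natrM exprD.
have h1 : ((x + k) ^_ k)%:R != 0 :> R.
  by rewrite pnatr_eq0 -lt0n ffact_gt0 leq_addl.
have h2 : x`!%:R != 0 :> R by rewrite pnatr_eq0 -lt0n fact_gt0.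
by field; rewrite h1 h2.
Qed.

(** * Orthogonality and the moments of a squared Charlier polynomial *)

Lemma sum_sign_bin {R : realType} (n : nat) :
  \sum_(j < n.+1) (-1) ^+ j * 'C(n, j)%:R = (n == 0)%:R :> R.
Proof.
have := exprDn (1 : R) (-1) n; rewrite subrr expr0n => ->.
by apply: eq_bigr => j _; rewrite expr1n mul1r mulr_natr.
Qed.

(* The value is, up to sign, the m-th difference of [l] at 0. *)
Lemma poisson_mean_charlierM {R : realType} (theta : R) (m : nat)
    (f : nat -> R) (l : nat -> R) : 0 < theta ->
  (forall j, poisson_mean theta (fun x => f (x + j)%N) (l j)) ->
  poisson_mean theta (fun x => charlier_poly theta m x * f x)
    (\sum_(j < m.+1) (-1) ^+ j * 'C(m, j)%:R * l j).
Proof.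
move=> t0 fl.
have /poisson_mean_sum : forall j : 'I_m.+1, poisson_mean theta
    (fun x => (-1) ^+ j * 'C(m, j)%:R * theta ^- j * ((x ^_ j)%:R * f x))
    ((-1) ^+ j * 'C(m, j)%:R * theta ^- j * (theta ^+ j * l j)).
  by move=> j; apply/poisson_meanZ/poisson_mean_ffact.
(* The power theta^j gained from the shift cancels the theta^-j of the expansion. *)
under [X in poisson_mean _ _ X]eq_bigr => j _ do
  rewrite mulrA (mulfVK (expf_neq0 _ (lt0r_neq0 t0))).
apply: poisson_mean_ext => x; rewrite mulr_suml.
by apply: eq_bigr => j _; rewrite mulrA.
Qed.

Lemma poisson_mean_charlier {R : realType} (theta : R) (n : nat) : 0 < theta ->
  poisson_mean theta (charlier_poly theta n) (n == 0)%:R.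
Proof.
move=> t0.
have := poisson_mean_charlierM _ n (fun=> 1) _ t0 (fun=> poisson_mean1 _ t0).
under [X in poisson_mean _ _ X]eq_bigr => j _ do rewrite mulr1.
by rewrite sum_sign_bin; apply: poisson_mean_ext => x; rewrite mulr1.
Qed.

(** In Newton's expansion the i-th difference is a multiple of C_{n-i}, whose mean is 0 for i < n,
    while the multiple itself is 0 for i > n. Only i = n contributes, so the mean vanishes for
    shifts j < n. *)
Lemma poisson_mean_charlier_translate {R : realType} (theta : R) (n j : nat) :
  0 < theta ->
  poisson_mean theta (fun x => charlier_poly theta n (x + j))
    ('C(j, n)%:R * (-1) ^+ n * n`!%:R * theta ^- n).
Proof.
move=> t0; have tN0 := lt0r_neq0 t0.
have /poisson_mean_sum : forall i : 'I_j.+1, poisson_mean theta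
    (fun x => 'C(j, i)%:R * charlier_diff theta n i x)
    ('C(j, i)%:R * ((-1) ^+ i * (n ^_ i)%:R * theta ^- i * (n - i == 0)%N%:R)).
  by move=> i; do 2 apply: poisson_meanZ; exact: poisson_mean_charlier.
rewrite [X in poisson_mean _ _ X](_ : _ =
    'C(j, n)%:R * (-1) ^+ n * n`!%:R * theta ^- n).
  apply: poisson_mean_ext => x.
  (* The difference of order 0 is C_n itself. *)
  have := charlier_diffD _ n 0 x j tN0.
  by rewrite {1}/charlier_diff ffactn0 !expr0 subn0 invr1 !mul1r => ->.
have termE (i : nat) : 'C(j, i)%:R *
    ((-1) ^+ i * (n ^_ i)%:R * theta ^- i * (n - i == 0)%N%:R) =
    if i == n then 'C(j, n)%:R * (-1) ^+ n * n`!%:R * theta ^- n else 0.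
  case: (ltngtP i n) => [lt_in|lt_ni|->].
  - by rewrite subn_eq0 leqNgt lt_in !mulr0.
  - by rewrite ffact_small // mulr0 !mul0r mulr0.
  - by rewrite subnn eqxx ffactnn mulr1 !mulrA.
under eq_bigr => i _ do rewrite termE.
rewrite -big_mkcond /=.
have [le_nj|lt_jn] := leqP n j; last first.
  by rewrite bin_small // !mul0r big1.
by rewrite (big_pred1 (Ordinal (le_nj : (n < j.+1)%N))).
Qed.

(** For m <= n, the m-th difference at 0 of the means of the translates C_n(x+j) involves only j <=
    m. These means vanish for j < n, so at most j = m = n survives. *)
Lemma poisson_mean_charlier_orthogonal {R : realType} (theta : R) (m n : nat) :
  0 < theta ->
  poisson_mean theta (fun x => charlier_poly theta m x * charlier_poly theta n x)
    ((m == n)%:R * (n`!%:R * theta ^- n)).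
Proof.
move=> t0; wlog le_mn : m n / (m <= n)%N.
  move=> le_mn; case: (leqP m n) => [/le_mn //|/ltnW/le_mn].
  have [->|_] // := eqVneq m n; rewrite !mul0r.
  by apply: poisson_mean_ext => x; rewrite mulrC.
have := poisson_mean_charlierM _ m _ _ t0
  (fun j => poisson_mean_charlier_translate _ n j t0).
rewrite big_ord_recr /= big1 ?add0r; last first.
  by move=> i _; rewrite (bin_small (leq_trans (ltn_ord i) le_mn)) !mul0r mulr0.
have [->|nmn] := eqVneq m n; last first.
  by rewrite (@bin_small m n) ?ltn_neqAle ?nmn // !mul0r mulr0.
have sE : (-1) ^+ n * (-1) ^+ n = 1 :> R by rewrite -expr2 sqrr_sign.
rewrite binn; congr poisson_mean.
transitivity ((-1) ^+ n * (-1) ^+ n * (n`!%:R * theta ^- n)); first by ring.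
by rewrite sE.
Qed.

(** Orthogonality of C_{n-i} and C_{n-j}. Since n - i is truncated, indices above n are treated
    apart, through the vanishing of their falling factorial. *)
Lemma poisson_mean_charlier_diffM {R : realType} (theta : R) (n i j : nat) :
  0 < theta ->
  poisson_mean theta
    (fun x => charlier_diff theta n i x * charlier_diff theta n j x)
    ((i == j)%:R * ((n ^_ i)%:R * n`!%:R * theta ^- i * theta ^- n)).
Proof.
move=> t0; have tN0 := lt0r_neq0 t0.
have := poisson_mean_charlier_orthogonal _ (n - i) (n - j) t0.
move=> /(poisson_meanZ _ _ _ (((-1) ^+ i * (n ^_ i)%:R * theta ^- i) *
  ((-1) ^+ j * (n ^_ j)%:R * theta ^- j))).
rewrite [X in poisson_mean _ _ X](_ : _ =
  (i == j)%:R * ((n ^_ i)%:R * n`!%:R * theta ^- i * theta ^- n)).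
  by apply: poisson_mean_ext => x; rewrite /charlier_diff; ring.
have [le_in|lt_ni] := leqP i n; last by rewrite ffact_small //; ring.
have [le_jn|lt_nj] := leqP j n; last first.
  rewrite (ffact_small lt_nj) (_ : i == j = false) ?mul0r; first by ring.
  by apply/negbTE; rewrite neq_ltn (leq_ltn_trans le_in).
(* As i, j <= n, adding i and j to both sides turns n - i = n - j into i = j. *)
rewrite -(eqn_add2r i) subnK // -(eqn_add2r j) addnAC subnK // eqn_add2l eq_sym.
have [<-|_] /= := eqVneq i j; last by rewrite !mul0r mulr0.
have sE : (-1) ^+ i * (-1) ^+ i = 1 :> R by rewrite -expr2 sqrr_sign.
have tE : theta ^- n = theta ^- i * theta ^- (n - i).
  by rewrite -invfM -exprD subnKC.
rewrite -(ffact_fact le_in) natrM tE.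
transitivity (((-1) ^+ i * (-1) ^+ i) * ((n ^_ i)%:R * ((n ^_ i)%:R * (n - i)`!%:R)
  * theta ^- i * (theta ^- i * theta ^- (n - i)))); first by ring.
by rewrite sE; ring.
Qed.

Lemma poisson_mean_ffact_charlier_sqr {R : realType} (theta : R) (k n : nat) :
  0 < theta ->
  poisson_mean theta (fun x => (x ^_ k)%:R * charlier theta n x%:R ^+ 2)
    (theta ^+ k * \sum_(i < k.+1) 'C(k, i)%:R ^+ 2 * (n ^_ i)%:R * theta ^- i).
Proof.
move=> t0; have tN0 := lt0r_neq0 t0; apply: poisson_mean_ffact => //.
have /poisson_mean_sum : forall i : 'I_k.+1, poisson_mean theta
    (fun x => \sum_(j < k.+1) ('C(k, i)%:R * 'C(k, j)%:R) *
      (charlier_diff theta n i x * charlier_diff theta n j x))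
    (\sum_(j < k.+1) ('C(k, i)%:R * 'C(k, j)%:R) *
      ((i == j :> nat)%:R * ((n ^_ i)%:R * n`!%:R * theta ^- i * theta ^- n))).
  move=> i; apply: poisson_mean_sum => j.
  exact/poisson_meanZ/poisson_mean_charlier_diffM.
move=> /(poisson_meanZ _ _ _ (theta ^+ n / n`!%:R)).
rewrite [X in poisson_mean _ _ X](_ : _ =
    \sum_(i < k.+1) 'C(k, i)%:R ^+ 2 * (n ^_ i)%:R * theta ^- i).
  apply: poisson_mean_ext => x; rewrite charlierE exprMn sqr_sqrtr; last first.
    by rewrite divr_ge0 // exprn_ge0 // ltW.
  congr (_ * _); have := charlier_diffD _ n 0 x k tN0.
  rewrite {1}/charlier_diff ffactn0 !expr0 subn0 invr1 !mul1r => ->.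
  rewrite expr2 mulr_suml; apply: eq_bigr => i _; rewrite mulr_sumr.
  by apply: eq_bigr => j _; rewrite !add0n; ring.
have f0 : n`!%:R != 0 :> R by rewrite pnatr_eq0 -lt0n fact_gt0.
rewrite mulr_sumr; apply: eq_bigr => i _.
(* Only the diagonal j = i survives; its factor n! theta^-n is cancelled by the squared
   normalisation. *)
rewrite (bigD1 i) //= eqxx big1 ?addr0; last first.
  by move=> j ji; rewrite eq_sym (negbTE ji : (j == i :> nat) = false) mul0r mulr0.
by rewrite /=; field; rewrite f0 !expf_neq0.
Qed.

(** * The moments of the ensemble and the 3F1 series *)

Lemma sum_ffact (n i : nat) : (\sum_(m < n) m ^_ i * i.+1 = n ^_ i.+1)%N.
Proof.
elim: n => [|n IH]; first by rewrite big_ord0.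
rewrite big_ord_recr /= IH ffactSS ffactnSr -mulnDr mulnC.
have [le_in|lt_ni] := leqP i n; last by rewrite ffact_small ?muln0.
by rewrite addnS subnK.
Qed.

(** Here [N] is the number of particles minus one, matching the upper parameter 1 - (N+1) = -N. *)
Lemma charlier_moment_cvg {R : realType} (theta : R) (k N : nat) : 0 < theta ->
  series (factorial_moment_term theta k N.+1) @ \oo -->
  theta ^+ k * \sum_(i < k.+1)
    'C(k, i)%:R ^+ 2 * (N ^_ i)%:R / i.+1%:R * theta ^- i.
Proof.
move=> t0.
have /poisson_mean_sum : forall n : 'I_N.+1, _ :=
  fun n => poisson_mean_ffact_charlier_sqr _ k n t0.
move=> /(poisson_meanZ _ _ _ N.+1%:R^-1).
rewrite [X in poisson_mean _ _ X](_ : _ = theta ^+ k * \sum_(i < k.+1)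
    'C(k, i)%:R ^+ 2 * (N ^_ i)%:R / i.+1%:R * theta ^- i).
  rewrite /poisson_mean; set g := (fun x => _ * poisson_pmf theta x).
  suff -> : g = factorial_moment_term theta k N.+1 by [].
  apply/funext => x; rewrite /g.
  rewrite /factorial_moment_term /charlier_one_point -mulr_sumr -mulr_suml.
  by ring.
rewrite -mulr_sumr exchange_big /= mulrCA mulr_sumr; congr (_ * _).
apply: eq_bigr => i _; rewrite -mulr_suml -mulr_sumr.
have n0 n : n.+1%:R != 0 :> R by rewrite pnatr_eq0.
(* Hockey-stick identity with (N+1)^_(i+1) = (N+1) N^_i; the factor N+1 cancels the averaging over
   the particles. *)
have -> : \sum_(n < N.+1) (n ^_ i)%:R = N.+1%:R * (N ^_ i)%:R / i.+1%:R :> R.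
  apply: (canRL (mulfK (n0 i))).
  by rewrite -natr_sum -!natrM -ffactSS -sum_ffact big_distrl.
by field; rewrite expf_neq0 ?lt0r_neq0 // -!natr1 !n0.
Qed.

(** The four signs, three from the upper parameters and one from the argument, cancel; (2)_i =
    (i+1)! yields the denominator i+1. *)
Lemma hypergeom_moment_term {R : realType} (theta : R) (k N i : nat) :
  hypergeom_term [:: - k%:R; - k%:R; 1 - N.+1%:R] [:: 2] (- theta^-1) i =
  'C(k, i)%:R ^+ 2 * (N ^_ i)%:R / i.+1%:R * theta ^- i.
Proof.
have -> : 1 - N.+1%:R = - N%:R :> R by rewrite -natr1; ring.
rewrite /hypergeom_term !big_cons !big_nil pochhammer2 !pochhammerN.
rewrite -bin_ffact factS !natrM [(- theta^-1) ^+ i]exprNn exprVn.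
have sE : (-1) ^+ i * (-1) ^+ i = 1 :> R by rewrite -expr2 sqrr_sign.
have f0 : i`!%:R != 0 :> R by rewrite pnatr_eq0 -lt0n fact_gt0.
rewrite !mulr1 invfM.
transitivity (((-1) ^+ i * (-1) ^+ i) ^+ 2 * (i`!%:R / i`!%:R) ^+ 2 *
  ('C(k, i)%:R ^+ 2 * (N ^_ i)%:R / i.+1%:R * theta ^- i)); first by ring.
by rewrite sE divff // !expr1n !mul1r.
Qed.

(** The free cut-off allows the same series to be read with k+1 terms, a range independent of N, or
    with N+1 terms, a range independent of k. *)
Lemma hypergeom_moment_sum {R : realType} (theta : R) (k N n : nat) :
  (minn k N < n)%N ->
  hypergeom [:: - k%:R; - k%:R; 1 - N.+1%:R] [:: 2] (- theta^-1) =
  \sum_(i < n) 'C(k, i)%:R ^+ 2 * (N ^_ i)%:R / i.+1%:R * theta ^- i.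
Proof.
move=> lt_n; rewrite (hypergeom_finite _ _ _ n).
  by apply: eq_bigr => i _; rewrite hypergeom_moment_term.
move=> i /(leq_trans lt_n); rewrite hypergeom_moment_term gtn_min => /orP[h|h].
  by rewrite bin_small // expr0n !mul0r.
by rewrite ffact_small // mulr0 !mul0r.
Qed.

(** * Polynomial dependence on k and on N - 1 *)

Definition ffact_poly {R : nzRingType} (i : nat) : {poly R} :=
  \prod_(j < i) ('X - j%:R%:P).

Lemma size_ffact_poly {R : nzRingType} (i : nat) :
  size (ffact_poly i : {poly R}) = i.+1.
Proof. by rewrite size_prod_XsubC /index_enum -enumT size_enum_ord. Qed.

Lemma horner_ffact_poly {R : comNzRingType} (i n : nat) :
  (ffact_poly i : {poly R}).[n%:R] = (n ^_ i)%:R.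
Proof.
rewrite /ffact_poly horner_prod; under eq_bigr => j _ do rewrite hornerXsubC.
elim: i => [|i IH]; first by rewrite big_ord0.
rewrite big_ord_recr /= IH ffactnSr natrM.
have [le_in|lt_ni] := leqP i n; first by rewrite natrB.
by rewrite ffact_small // !mul0r.
Qed.

(** The leading term of the last summand cannot be cancelled by summands of smaller size. *)
Lemma size_sum_scale_last {F : idomainType} (n : nat) (c : nat -> F)
    (P : nat -> {poly F}) :
  c n != 0 -> (forall i, (i < n)%N -> (size (P i) < size (P n))%N) ->
  size (\sum_(i < n.+1) c i *: P i) = size (P n).
Proof.
move=> cn0; case: n cn0 => [|n] cn0 ltP.
  by rewrite big_ord1 size_scale.
rewrite big_ord_recr /= addrC size_polyDl ?size_scale //.
(* The last size is a successor, so the strict bound becomes a weak one, which passes to the maximum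
   over the other summands. *)
rewrite -(ltn_predK (ltP n (leqnn _))) ltnS.
apply: leq_trans (size_sum _ _ _) _; apply/bigmax_leqP => i _.
apply: leq_trans (size_scale_leq _ _) _.
by rewrite -ltnS (ltn_predK (ltP n (leqnn _))) ltP.
Qed.

Theorem theorem4 (R : realType) (theta : R) (theta_gt0 : 0 < theta) :
  (forall N k : nat, (1 <= N)%N ->
     cvgn (series (factorial_moment_term theta k N)) /\
     factorial_moment theta k N =
       theta ^+ k *
       hypergeom [:: - k%:R; - k%:R; 1 - N%:R] [:: 2] (- theta^-1)) /\
  (forall N : nat, (1 <= N)%N ->
     exists p : {poly R[i]},
       size p = (2 * (N - 1)).+1 /\
       forall k : nat,
         p.[k%:R] = real_complex R (theta ^- k * factorial_moment theta k N)) /\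
  (forall k : nat,
     exists q : {poly R},
       size q = k.+1 /\
       forall N : nat, (1 <= N)%N ->
         theta ^- k * factorial_moment theta k N = q.[(N - 1)%:R]).
Proof.
have tN0 := lt0r_neq0 theta_gt0.
have momentE N k : factorial_moment theta k N.+1 = theta ^+ k *
    hypergeom [:: - k%:R; - k%:R; 1 - N.+1%:R] [:: 2] (- theta^-1).
  rewrite (hypergeom_moment_sum _ _ _ k.+1) ?ltnS ?geq_minl //.
  exact/cvg_lim/charlier_moment_cvg.
have normE N k : theta ^- k * factorial_moment theta k N.+1 =
    hypergeom [:: - k%:R; - k%:R; 1 - N.+1%:R] [:: 2] (- theta^-1).
  by rewrite momentE mulKf // expf_neq0.
split; last split.
- case=> // N k _; split=> //; apply/cvg_ex; eexists.
  exact: charlier_moment_cvg.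
- case=> // N _; rewrite subSS subn0.
  (* Writing binom(k,i) as k^_i / i! makes the i-th term [c i] times the square of a falling
     factorial in k, of degree 2i. *)
  pose c i : R := (N ^_ i)%:R / (i.+1%:R * i`!%:R ^+ 2) * theta ^- i.
  pose p : {poly R} := \sum_(i < N.+1) c i *: ffact_poly i ^+ 2.
  have size_sqr i : size (ffact_poly i ^+ 2 : {poly R}) = (2 * i).+1.
    rewrite expr2 size_mul -?size_poly_eq0 size_ffact_poly //.
    by rewrite addnS addSn /= addnn -mul2n.
  exists (map_poly (real_complex R) p); split.
    (* The embedding into the complex numbers preserves the degree, and [c N] is nonzero because
       [N ^_ N] is positive. *)
    rewrite size_map_poly
      (size_sum_scale_last N c (fun i => ffact_poly i ^+ 2)) //.
      by rewrite !mulf_neq0 ?invr_neq0 ?mulf_neq0 ?expf_neq0 ?pnatr_eq0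
        -?lt0n ?ffact_gt0 ?fact_gt0.
    by move=> i lt_iN; rewrite !size_sqr ltnS ltn_pmul2l.
  move=> k; rewrite -(rmorph_nat (real_complex R)) horner_map; congr (_%:C)%C.
  rewrite normE (hypergeom_moment_sum _ _ _ N.+1) ?ltnS ?geq_minr //.
  rewrite horner_sum; apply: eq_bigr => i _.
  rewrite hornerZ horner_exp horner_ffact_poly /c -(bin_ffact k) natrM.
  have f0 : i`!%:R != 0 :> R by rewrite pnatr_eq0 -lt0n fact_gt0.
  by field; rewrite f0 expf_neq0 // nat1r pnatr_eq0.
- move=> k.
  (* Now N enters only through the falling factorial N^_i, and [c k] is nonzero since binom(k,k) =
     1. *)
  pose c i : R := 'C(k, i)%:R ^+ 2 / i.+1%:R * theta ^- i.
  exists (\sum_(i < k.+1) c i *: ffact_poly i); split.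
    rewrite (size_sum_scale_last k c ffact_poly) ?size_ffact_poly //.
      by rewrite /c binn !mulf_neq0 ?invr_neq0 ?expf_neq0 ?pnatr_eq0.
    by move=> i lt_ik; rewrite !size_ffact_poly.
  case=> // N _; rewrite subSS subn0 normE.
  rewrite (hypergeom_moment_sum _ _ _ k.+1) ?ltnS ?geq_minl // horner_sum.
  by apply: eq_bigr => i _; rewrite hornerZ horner_ffact_poly /c; ring.
Qed.
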